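(* Let $f:\mathbb{R}^n\to\mathbb{R}^n$ be a homogeneous polynomial vector field and consider the system $\dot x=f(x)$. Suppose there exists a homogeneous polynomial $V:\mathbb{R}^n\to\mathbb{R}$ such that $V$ and $-\dot V=-\langle\nabla V(x),f(x)\rangle$ are positive definite. Then there also exists a homogeneous polynomial $W:\mathbb{R}^n\to\mathbb{R}$ such that $W$ and $-\dot W=-\langle\nabla W(x),f(x)\rangle$ are both sums of squares (and both positive definite).
   Context: All vector fields $f$ are polynomial with $f(0)=0$. The vector field $f$ is homogeneous if all entries of $f$ are homogeneous polynomials of the same degree. A polynomial $V$ of degree $d$ is homogeneous if $V(\lambda x)=\lambda^d V(x)$ for every scalar $\lambda\in\mathbb{R}$. A function $V:\mathbb{R}^n\to\mathbb{R}$ is positive definite if $V(x)>0$ for all $x\neq 0$. A polynomial is a sum of squares (sos) if it equals $\sum_i q_i^2$ for finitely many real polynomials $q_i$. $\dot V(x)=\langle\nabla V(x),f(x)\rangle$ is the derivative of $V$ along trajectories of $\dot x=f(x)$. *)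

(* Defs.v *)
From HB Require Import structures.
From mathcomp Require Import all_boot all_order all_algebra.
From mathcomp Require Import mpoly.
From mathcomp Require Import reals.
Set Implicit Arguments.
Unset Strict Implicit.
Unset Printing Implicit Defensive.
Import Order.TTheory GRing.Theory Num.Theory.
Local Open Scope ring_scope.

Definition mpeval (R : realType) (n : nat) (p : {mpoly R[n]}) (x : 'rV[R]_n) : R :=
  p.@[fun i => x 0 i].

(* The zero polynomial is homogeneous of every degree, so zero entries are
   allowed. *)
Definition homogeneous_vf (R : realType) (n : nat) (f : 'I_n -> {mpoly R[n]}) : Prop :=
  exists d : nat, forall i, f i \is d.-homog.

Definition posdef (R : realType) (n : nat) (p : {mpoly R[n]}) : Prop :=
  forall x : 'rV[R]_n, x != 0 -> 0 < mpeval p x.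

Definition sos (R : realType) (n : nat) (p : {mpoly R[n]}) : Prop :=
  exists qs : seq {mpoly R[n]}, p = \sum_(q <- qs) q ^+ 2.

(* The polynomial <grad V, f>, i.e. the derivative of V along the trajectories
   of x' = f(x). *)
Definition Vdot (R : realType) (n : nat) (f : 'I_n -> {mpoly R[n]})
    (V : {mpoly R[n]}) : {mpoly R[n]} :=
  \sum_(i < n) V^`M(i) * f i.

Lemma horner_all0 (R : realType) (q : {poly R}) : (forall t, q.[t] = 0) -> q = 0.
Proof.
move=> q0; apply/eqP/negPn/negP => qN0.
pose rs := [seq (i%:R : R) | i <- iota 0 (size q)].
have /(max_poly_roots qN0) : all (root q) rs.
  by apply/allP => x _; rewrite /root q0.
rewrite map_inj_uniq ?iota_uniq => [|i j /eqP]; last by rewrite eqr_nat => /eqP.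
by move=> /(_ isT); rewrite size_map size_iota ltnn.
Qed.

Lemma muni_mcoeff (R : realType) n (p : {mpoly R[n.+1]}) (m : 'X_{1..n.+1}) :
  ((muni p)`_(m ord_max))@_[multinom m (widen_ord (leqnSn n) i) | i < n] = p@_m.
Proof.
rewrite muniE coef_sum raddf_sum {3}[p]mpolyE raddf_sum /=.
apply: eq_bigr => k _; rewrite coefZ coefXn mcoeffZ mcoeffX.
have [->|neq] := eqVneq k m; first by rewrite eqxx mulr1 mcoeffZ mcoeffX eqxx.
case: eqVneq => [e1|_]; last by rewrite mulr0 mcoeff0 mulr0.
rewrite mulr1 mcoeffZ mcoeffX; case: eqVneq => // /mnmP e2.
case/eqP: neq; apply/mnmP => i.
case: (unliftP ord_max i) => [j ->|->]; last by rewrite e1.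
have -> : lift ord_max j = widen_ord (leqnSn n) j.
  by apply/val_inj; rewrite /= /bump leqNgt ltn_ord.
by have := e2 j; rewrite !mnmE.
Qed.

Lemma meval_muni (R : realType) n (p : {mpoly R[n.+1]}) (v : 'I_n.+1 -> R) :
  p.@[v] = (map_poly (meval (fun i => v (widen_ord (leqnSn n) i))) (muni p)).[v ord_max].
Proof.
rewrite muniE rmorph_sum horner_sum mevalE; apply: eq_bigr => m _.
rewrite /= map_polyZ hornerZ map_polyXn hornerXn /=.
rewrite mevalZ mevalX -mulrA.
rewrite big_ord_recr /=; congr (_ * (_ * _)).
by apply: eq_bigr => i _; rewrite mnmE.
Qed.

Lemma meval_all0 (R : realType) n (p : {mpoly R[n]}) : (forall v, p.@[v] = 0) -> p = 0.
Proof.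
elim: n p => [|n IH] p p0.
  apply/mpolyP => m; rewrite mcoeff0 -(p0 (fun=> 0)) {2}[p]mpolyE raddf_sum /=.
  rewrite {1}[p]mpolyE raddf_sum /=; apply: eq_bigr => k _.
  have -> : m = k by apply/mnmP => -[].
  by rewrite mcoeffZ mevalZ mcoeffX eqxx mevalX big_ord0.
suff u0 : muni p = 0.
  by apply/mpolyP => m; rewrite -muni_mcoeff u0 coef0 !mcoeff0.
apply/polyP => j; rewrite coef0; apply: IH => v.
rewrite -(coef_map (meval v)) (_ : map_poly _ _ = 0) ?coef0 //.
apply: horner_all0 => t.
pose w (i : 'I_n.+1) := if unlift ord_max i is Some k then v k else t.
rewrite -[RHS](p0 w) meval_muni {2}/w unlift_none.
congr (_.[_]); apply: eq_map_poly => q; apply: meval_eq => i; rewrite /w.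
have -> : widen_ord (leqnSn n) i = lift ord_max i.
  by apply/val_inj; rewrite /= /bump leqNgt ltn_ord.
by rewrite liftK.
Qed.

(* The monomial-wise predicate [d.-homog] of the library agrees with the
   definition of homogeneity by scaling. *)
Lemma dhomog_scaling (R : realType) n d (p : {mpoly R[n]}) :
  p \is d.-homog <->
  forall (lambda : R) (x : 'rV[R]_n), mpeval p (lambda *: x) = lambda ^+ d * mpeval p x.
Proof.
have hom_scale e (q : {mpoly R[n]}) t (v : 'I_n -> R) : q \is e.-homog ->
    q.@[fun i => t * v i] = t ^+ e * q.@[v].
  move=> /dhomogP hq; rewrite !mevalE mulr_sumr [LHS]big_seq [RHS]big_seq.
  apply: eq_bigr => m /hq /= hm; have {}hm : mdeg m = e by [].
  rewrite mulrCA -hm mdegE expr_sum -big_split /=; congr (_ * _).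
  by apply: eq_bigr => i _; rewrite exprMn.
split=> [hp t x|hp].
  by rewrite /mpeval -hom_scale //; apply: meval_eq => i; rewrite mxE.
have comp0 e : e != d -> pihomog mdeg e p = 0.
  move=> ne; apply: meval_all0 => v; pose k := (maxn (msize p) (maxn d e).+1).
  have pE : p = \sum_(j < k) pihomog mdeg j p.
    by apply: pihomog_partitionE; rewrite leq_maxl.
  have /polyP/(_ e) : \poly_(j < k) (pihomog mdeg j p).@[v] - p.@[v] *: 'X^d = 0.
    apply: horner_all0 => t; rewrite !hornerE horner_poly.
    have /= := hp t (\row_i v i).
    rewrite /mpeval (@meval_eq _ _ _ (fun i => t * v i)) => [|i]; last by rewrite !mxE.
    rewrite [X in _ = _ * X](@meval_eq _ _ _ v) => [|i]; last by rewrite mxE.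
    rewrite mulrC => <-; apply/eqP; rewrite subr_eq0; apply/eqP.
    rewrite {2}pE raddf_sum /=; apply: eq_bigr => j _.
    by rewrite (hom_scale j) ?pihomogP // mulrC.
  rewrite coef0 coefB coef_poly coefZ coefXn (negbTE ne) mulr0 subr0.
  by rewrite /k !leq_max ltnS leq_max leqnn !orbT.
rewrite (pihomog_partitionE (mf := mdeg) (leq_maxl (msize p) d)).
apply: rpred_sum => j _; have [jd|/comp0 ->] := eqVneq (j : nat) d.
  by have := pihomogP mdeg j p; rewrite jd.
exact: rpred0.
Qed.

(* Main.v *)
Require Import Defs.
From HB Require Import structures.
From mathcomp Require Import all_boot all_order all_algebra.
From mathcomp Require Import reals.
From mathcomp Require boolp classical_sets topology normedtype derive.
Set Implicit Arguments.
Unset Strict Implicit.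
Unset Printing Implicit Defensive.
Import Order.TTheory GRing.Theory Num.Theory.
Local Open Scope ring_scope.

(** The function W is an even power of V.  Put U = V^2 and g = - V (Vdot f V), a
    positive definite form; then - Vdot f (U^(k+1)) = 2 (k+1) U^k g, and U^(k+1)
    is a square, so it suffices that U^k g be a sum of squares for some k.  That
    this holds for any positive definite forms V and g, with V not constant, is a
    theorem of Scheiderer ([sos_posdef_mul_powers]); the proof given here avoids
    real algebraic geometry and has two stages.

    The first stage is the case U = |x|^2, a theorem of Reznick ([reznick]):
    for a positive definite form p of degree 2e, |x|^(2m) p is a sum of squares
    for every large m.  Compactness of the sphere gives mu > 0 with
    p >= mu |x|^(2e).  Add a variable t standing for |x| and consider
    p(x) - mu |x|^(2e) + mu t^(2e).  It equals p modulo t^2 - |x|^2 and is at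
    least mu t^(2e) everywhere.  Choose linear forms l_0, ..., l_n in (x, t) that
    are positive multiples of t + x_j and of a sum of the t - x_j, and that add up
    to t.  By the theorem of Polya ([polya]) a large power of t times the form
    above has nonnegative coefficients when written in the l_i.  Modulo
    t^2 - |x|^2 each t l_i is a sum of squares, because
    2 t (t +- x_j) = (t +- x_j)^2 + (|x|^2 - x_j^2) + (t^2 - |x|^2).  So the
    product of p with a power of t^2 is a sum of squares modulo t^2 - |x|^2, and
    taking the part that is even in t gives a sum of squares of polynomials in x
    alone.

    The second stage passes from |x|^2 to U.  Call h saturated when U^k h is a
    sum of squares for some k; saturated polynomials are closed under sums and
    products, and a factor U may be cancelled.  Let s be a small multiple of
    |x|^(2d), where d is the degree of V.  By the first stage s^m (U - s) and
    s^m (g - eps |x|^(2e)) are saturated, and K s - U is a sum of squares for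
    large K ([homog_dominates]).  These facts say that s / U is invertible and bounded by 1
    for the order defined by saturated polynomials, and the factor s^m is removed
    by a truncated geometric series for its inverse ([saturated_perturb]). *)

(** * Minimum of a polynomial function on the sphere *)

Section Compactness.
Import boolp classical_sets topology normedtype derive.
Import numFieldNormedType.Exports.
Local Open Scope classical_set_scope.

(** A polynomial is represented by the list [s] of its terms, with coefficients
    [c] and exponents [a], so that the topological part does not depend on the
    construction of multivariate polynomials. *)
Lemma continuous_polynomial_function (R : realType) (n : nat) (I : Type)
    (s : seq I) (c : I -> R) (a : I -> 'I_n -> nat) :
  continuous (fun x : 'rV[R]_n => \sum_(j <- s) c j * \prod_i x 0 i ^+ a j i).
Proof.
have cM (g h : 'rV[R]_n -> R) : continuous g -> continuous h ->
    continuous (fun x => g x * h x).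
  by move=> cg ch x; apply: (@cvgM R _ (nbhs x) _ g h); [exact (cg x)|exact (ch x)].
have cX (i : 'I_n) k : continuous (fun x : 'rV[R]_n => x 0 i ^+ k).
  elim: k => [|k IH]; first by move=> x; apply: cst_continuous.
  under eq_fun do rewrite exprS.
  by apply: cM; [exact: coord_continuous|exact: IH].
apply: continuous_big => [|j _]; first exact: add_continuous.
apply: cM; first by move=> x; apply: cst_continuous.
apply: continuous_big => [|i _]; [exact: mul_continuous|exact: cX].
Qed.

Lemma polynomial_function_min_sphere (R : realType) (n : nat) (I : Type)
    (s : seq I) (c : I -> R) (a : I -> 'I_n.+1 -> nat)
    (F := fun x : 'rV[R]_n.+1 => \sum_(j <- s) c j * \prod_i x 0 i ^+ a j i) :
  exists2 z : 'rV[R]_n.+1, \sum_i z 0 i ^+ 2 = 1 &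
    forall x : 'rV[R]_n.+1, \sum_i x 0 i ^+ 2 = 1 -> F z <= F x.
Proof.
pose N (x : 'rV[R]_n.+1) : R := \sum_i x 0 i ^+ 2.
have cN : continuous N.
  have -> : N = fun x => \sum_(j <- index_enum 'I_n.+1)
       1 * \prod_i x 0 i ^+ (if i == j then 2 else 0).
    apply/funext => x; rewrite /N; apply: eq_bigr => j _.
    rewrite mul1r (bigD1 j) //= eqxx big1 ?mulr1 // => i /negbTE ->.
    by rewrite expr0.
  exact: continuous_polynomial_function.
have cS : compact [set x | N x = 1].
  apply: bounded_closed_compact; last first.
    apply: (@preimage_closed _ _ N [set y | y = 1]); last exact: closed_eq.
    by move=> x _; exact (cN x).
  exists 1; split=> // t t1 x /= Nx.
  rewrite (le_trans _ (ltW t1)) //.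
  have -> : `|x| = mx_norm x by [].
  rewrite mx_normrE; apply: bigmax_le => // -[i j] _ /=; rewrite ord1.
  rewrite -(@expr_le1 _ 2) // real_normK ?num_real // -Nx /N (bigD1 j) //=.
  by rewrite lerDl sumr_ge0 // => k _; rewrite sqr_ge0.
have /(EVT_min_rV (n := n.+1)) : [set x | N x = 1] !=set0.
  exists (delta_mx 0 0); rewrite /= /N (bigD1 0) //= mxE eqxx expr1n big1 ?addr0 //.
  by move=> i /negbTE i0; rewrite mxE i0 andbF expr0n.
move=> /(_ F cS) [].
  by apply: continuous_subspaceT; exact: continuous_polynomial_function.
move=> z /set_mem zS zmin; exists z => // x xS; apply: zmin.
exact/mem_set.
Qed.

End Compactness.

From mathcomp Require Import mpoly ring.

(** * Sums of squares modulo a principal ideal *)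

(** One notion serves two purposes: d = 0 gives sums of squares in S, and
    d = t^2 - |x|^2 in a polynomial ring in t gives sums of squares on the cone
    where t is plus or minus the norm of x. *)
Definition sos_mod (S : comNzRingType) (d g : S) : Prop :=
  exists (qs : seq S) (h : S), g = \sum_(q <- qs) q ^+ 2 + d * h.

Section SosMod.
Variables (S : comNzRingType) (d : S).

Lemma sos_mod_sqr q : sos_mod d (q ^+ 2).
Proof. by exists [:: q], 0; rewrite big_seq1 mulr0 addr0. Qed.

Lemma sos_mod0 : sos_mod d 0.
Proof. by have := sos_mod_sqr 0; rewrite expr0n. Qed.

Lemma sos_mod1 : sos_mod d 1.
Proof. by have := sos_mod_sqr 1; rewrite expr1n. Qed.

Lemma sos_modD g1 g2 : sos_mod d g1 -> sos_mod d g2 -> sos_mod d (g1 + g2).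
Proof.
move=> [q1 [h1 ->]] [q2 [h2 ->]]; exists (q1 ++ q2), (h1 + h2).
by rewrite big_cat /= mulrDr addrACA.
Qed.

Lemma sos_modM g1 g2 : sos_mod d g1 -> sos_mod d g2 -> sos_mod d (g1 * g2).
Proof.
move=> [q1 [h1 ->]] [q2 [h2 ->]].
exists [seq a * b | a <- q1, b <- q2].
exists (h1 * (\sum_(q <- q2) q ^+ 2 + d * h2) + (\sum_(q <- q1) q ^+ 2) * h2).
rewrite big_allpairs_dep /=.
have -> : \sum_(a <- q1) \sum_(b <- q2) (a * b) ^+ 2 =
          (\sum_(q <- q1) q ^+ 2) * (\sum_(q <- q2) q ^+ 2).
  rewrite big_distrlr /=; apply: eq_bigr => a _; apply: eq_bigr => b _.
  exact: exprMn.
by ring.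
Qed.

Lemma sos_modX g k : sos_mod d g -> sos_mod d (g ^+ k).
Proof.
move=> sg; elim: k => [|k IH]; first exact: sos_mod1.
by rewrite exprS; exact: sos_modM.
Qed.

Lemma sos_mod_sum (I : Type) (r : seq I) (P : pred I) (F : I -> S) :
  (forall i, P i -> sos_mod d (F i)) -> sos_mod d (\sum_(i <- r | P i) F i).
Proof. by move=> sF; apply: big_ind => //; [exact: sos_mod0|exact: sos_modD]. Qed.

Lemma sos_mod_prod (I : Type) (r : seq I) (P : pred I) (F : I -> S) :
  (forall i, P i -> sos_mod d (F i)) -> sos_mod d (\prod_(i <- r | P i) F i).
Proof. by move=> sF; apply: big_ind => //; [exact: sos_mod1|exact: sos_modM]. Qed.

End SosMod.

Section Sos.
Variables (R : realType) (n : nat).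
Implicit Types (p q : {mpoly R[n]}).

Lemma sosE p : sos p <-> sos_mod 0 p.
Proof.
split=> [[qs ->]|[qs [h ->]]]; last by exists qs; rewrite mul0r addr0.
by exists qs, 0; rewrite mul0r addr0.
Qed.

Lemma sos_sqr p : sos (p ^+ 2).
Proof. exact/sosE/sos_mod_sqr. Qed.

Lemma sos0 : sos (0 : {mpoly R[n]}).
Proof. exact/sosE/sos_mod0. Qed.

Lemma sos1 : sos (1 : {mpoly R[n]}).
Proof. exact/sosE/sos_mod1. Qed.

Lemma sosD p q : sos p -> sos q -> sos (p + q).
Proof. by move=> /sosE sp /sosE sq; exact/sosE/sos_modD. Qed.

Lemma sosM p q : sos p -> sos q -> sos (p * q).
Proof. by move=> /sosE sp /sosE sq; exact/sosE/sos_modM. Qed.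

Lemma sosX p k : sos p -> sos (p ^+ k).
Proof. by move=> /sosE sp; exact/sosE/sos_modX. Qed.

Lemma sos_sum (I : Type) (r : seq I) (P : pred I) (F : I -> {mpoly R[n]}) :
  (forall i, P i -> sos (F i)) -> sos (\sum_(i <- r | P i) F i).
Proof. by move=> sF; apply/sosE/sos_mod_sum => i /sF /sosE. Qed.

Lemma mpolyC_sqr (c : R) : 0 <= c -> c%:MP_[n] = (Num.sqrt c)%:MP ^+ 2.
Proof. by move=> c0; rewrite expr2 -mpolyCM -expr2 sqr_sqrtr. Qed.

Lemma sosC (c : R) : 0 <= c -> sos c%:MP_[n].
Proof. by move=> /mpolyC_sqr ->; exact: sos_sqr. Qed.

Lemma sosZ (c : R) p : 0 <= c -> sos p -> sos (c *: p).
Proof. by move=> c0 sp; rewrite -mul_mpolyC; apply: sosM => //; exact: sosC. Qed.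

End Sos.

(** * Domination of a form by a power of the squared norm *)

Section Domination.
Variables (R : realType) (n : nat).
Implicit Types (p q : {mpoly R[n]}).

Definition sqnorm : {mpoly R[n]} := \sum_i 'X_i ^+ 2.

(** The inequality |q| <= p, for the order whose positive elements are the sums
    of squares. *)
Definition dominates p q : Prop := sos (p + q) /\ sos (p - q).

Lemma sos_sqnorm : sos sqnorm.
Proof. by apply: sos_sum => i _; exact: sos_sqr. Qed.

Lemma dominatesD p1 p2 q1 q2 :
  dominates p1 q1 -> dominates p2 q2 -> dominates (p1 + p2) (q1 + q2).
Proof.
move=> [a1 b1] [a2 b2]; split; first by rewrite addrACA; exact: sosD.
by rewrite opprD addrACA; exact: sosD.
Qed.

Lemma sos_halve p : sos (p *+ 2) -> sos p.
Proof.
move=> sp; have -> : p = 2^-1 *: (p *+ 2).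
  by rewrite -scaler_nat scalerA mulVf ?scale1r // pnatr_eq0.
by apply: sosZ => //; rewrite invr_ge0 ler0n.
Qed.

(** Both polynomials 2 (p1 p2 +- q1 q2) are sums of two products of one
    of p1 +- q1 with one of p2 +- q2. *)
Lemma dominatesM p1 p2 q1 q2 :
  dominates p1 q1 -> dominates p2 q2 -> dominates (p1 * p2) (q1 * q2).
Proof.
move=> [a1 b1] [a2 b2]; split; apply: sos_halve.
  have -> : (p1 * p2 + q1 * q2) *+ 2 =
            (p1 + q1) * (p2 + q2) + (p1 - q1) * (p2 - q2) by ring.
  by apply: sosD; exact: sosM.
have -> : (p1 * p2 - q1 * q2) *+ 2 =
          (p1 + q1) * (p2 - q2) + (p1 - q1) * (p2 + q2) by ring.
by apply: sosD; exact: sosM.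
Qed.

Lemma dominatesZ (c : R) p q : dominates p q -> dominates (`|c| *: p) (c *: q).
Proof.
move=> [a b]; have [c0|c0] := leP 0 c.
  by rewrite (ger0_norm c0); split; rewrite -?scalerBr -?scalerDr; apply: sosZ.
have c0' : 0 <= - c by rewrite oppr_ge0 ltW.
rewrite (ltr0_norm c0); have -> : c *: q = - ((- c) *: q) by rewrite scaleNr opprK.
by split; rewrite ?opprK -?scalerBr -?scalerDr; apply: sosZ.
Qed.

Lemma sos_sqnormB (k : 'I_n) : sos (sqnorm - 'X_k ^+ 2).
Proof.
rewrite /sqnorm (bigD1 k) //= addrAC subrr add0r.
by apply: sos_sum => l _; exact: sos_sqr.
Qed.

Lemma dominates_mulXX (i j : 'I_n) : dominates sqnorm ('X_i * 'X_j).
Proof.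
split; apply: sos_halve.
  have -> : (sqnorm + 'X_i * 'X_j) *+ 2 = ('X_i + 'X_j) ^+ 2 +
     ((sqnorm - 'X_i ^+ 2) + (sqnorm - 'X_j ^+ 2)) by ring.
  by apply: sosD; [exact: sos_sqr|apply: sosD; exact: sos_sqnormB].
have -> : (sqnorm - 'X_i * 'X_j) *+ 2 = ('X_i - 'X_j) ^+ 2 +
   ((sqnorm - 'X_i ^+ 2) + (sqnorm - 'X_j ^+ 2)) by ring.
by apply: sosD; [exact: sos_sqr|apply: sosD; exact: sos_sqnormB].
Qed.

Lemma mdeg_gt0_split (m : 'X_{1..n}) : (0 < mdeg m)%N ->
  exists i m', m = (U_(i) + m')%MM.
Proof.
rewrite lt0n mdeg_eq0 => m0.
have [i mi] : exists i, m i != 0%N.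
  apply/existsP; apply: contraNT m0 => /existsPn h.
  by apply/eqP/mnmP => i; rewrite mnm0E; have := h i; rewrite negbK => /eqP.
exists i, (m - U_(i))%MM; rewrite addmC submK //.
by apply/mnm_lepP => j; rewrite mnm1E; case: eqP => [<-|]; rewrite ?lt0n.
Qed.

Lemma dominates_monomial e (m : 'X_{1..n}) : mdeg m = (2 * e)%N ->
  dominates (sqnorm ^+ e) 'X_[m].
Proof.
elim: e m => [|e IH] m.
  move=> /eqP; rewrite mdeg_eq0 => /eqP ->; rewrite expr0 mpolyX0.
  by split; [apply: sosD; exact: sos1|rewrite subrr; exact: sos0].
rewrite mulnS => dm.
have [|i [m1 m1E]] := @mdeg_gt0_split m; first by rewrite dm.
have dm1 : mdeg m1 = (2 * e).+1 by move: dm; rewrite m1E mdegD mdeg1 => -[].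
have [|j [m2 m2E]] := @mdeg_gt0_split m1; first by rewrite dm1.
have dm2 : mdeg m2 = (2 * e)%N by move: dm1; rewrite m2E mdegD mdeg1 => -[].
rewrite m1E m2E addmA !mpolyXD exprS; apply: dominatesM; last exact: IH.
exact: dominates_mulXX.
Qed.

(** A monomial of degree 2e is a product of e monomials x_i x_j, each dominated
    by |x|^2. *)
Lemma homog_dominates e p : p \is (2 * e).-homog ->
  exists2 K : R, 0 < K & dominates (K *: sqnorm ^+ e) p.
Proof.
move=> hp.
(* The summand 1 makes the constant positive when p = 0. *)
exists (1 + \sum_(m <- msupp p) `|p@_m|).
  by rewrite ltr_pwDl // sumr_ge0.
rewrite scalerDl scale1r -[p in X in dominates _ X]add0r; apply: dominatesD.
  by split; rewrite ?addr0 ?subr0; apply: sosX; exact: sos_sqnorm.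
rewrite [p in X in dominates _ X]mpolyE scaler_suml.
rewrite [X in dominates X _]big_seq [X in dominates _ X]big_seq.
apply: (big_ind2 dominates) => [|p1 p2 q1 q2|m mp].
- by split; rewrite ?subr0 ?addr0; exact: sos0.
- exact: dominatesD.
- by apply: dominatesZ; apply: dominates_monomial; exact: (dhomogP _ _ _ hp).
Qed.

End Domination.

(** * The theorem of Polya on forms positive on the orthant *)

Section Polya.
Variables (R : realType) (n : nat).
Implicit Types (F G : {mpoly R[n]}) (a b : 'X_{1..n}).

Definition mfact b : nat := \prod_i (b i)`!.
Definition mffact b a : nat := \prod_i (b i) ^_ (a i).

Lemma mfact_gt0 b : (0 < mfact b)%N.
Proof. by rewrite prodn_gt0 // => i; exact: fact_gt0. Qed.

Lemma mffact_small b a i : (b i < a i)%N -> mffact b a = 0%N.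
Proof. by move=> ba; rewrite /mffact (bigD1 i) //= ffact_small. Qed.

Lemma mffactnn b : mffact b b = mfact b.
Proof. by apply: eq_bigr => i _; rewrite ffactnn. Qed.

(** If the degrees agree and a differs from b, some a_i exceeds b_i. *)
Lemma mffact_eq_deg b a : mdeg a = mdeg b -> a != b -> mffact b a = 0%N.
Proof.
move=> dab ab; have [/existsP[i]|/existsPn h] := boolP [exists i, (b i < a i)%N].
  exact: mffact_small.
case/eqP: ab; apply/mnmP => i; apply/eqP; move: dab; rewrite !mdegE.
have le i0 : (a i0 <= b i0)%N by rewrite leqNgt h.
move=> /eqP; rewrite (leqif_sum (fun i0 _ => leqif_eq (le i0))).
by move=> /forallP/(_ i).
Qed.

Lemma mffact_rec b a i :
  (b i * mffact (b - U_(i)) a = (b i - a i) * mffact b a)%N.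
Proof.
rewrite /mffact (bigD1 i) //= [in RHS](bigD1 i) //= !mulnA.
have -> : \prod_(j < n | j != i) ((b - U_(i))%MM j) ^_ (a j) =
          \prod_(j < n | j != i) (b j) ^_ (a j).
  by apply: eq_bigr => j ji; rewrite mnmBE mnm1E eq_sym (negbTE ji) subn0.
congr (_ * _)%N; rewrite mnmBE mnm1E eqxx subn1.
by case: (b i) => [|k] //=; rewrite -ffactnS mulnC -ffactnSr.
Qed.

Lemma mfact_rec b i : (0 < b i)%N -> mfact b = (b i * mfact (b - U_(i)))%N.
Proof.
move=> bi; rewrite /mfact (bigD1 i) //= [in RHS](bigD1 i) //= mulnA.
congr (_ * _)%N; last first.
  by apply: eq_bigr => j ji; rewrite mnmBE mnm1E eq_sym (negbTE ji) subn0.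
by rewrite mnmBE mnm1E eqxx subn1; case: (b i) bi.
Qed.

Lemma mcoeff_mulX F b i :
  ('X_i * F)@_b = if (0 < b i)%N then F@_(b - U_(i)) else 0.
Proof.
rewrite mulrC; case: ifPn => [bi|].
  rewrite -[b in LHS](@submK _ U_(i)); last first.
    by apply/mnm_lepP => j; rewrite mnm1E; case: eqP => [<-|].
  by rewrite addmC mcoeffMX.
rewrite -eqn0Ngt => /eqP bi; apply: memN_msupp_eq0.
rewrite (perm_mem (msuppMX _ _)); apply/negP => /mapP[m _ bE].
by move: bi; rewrite bE mnmDE mnm1E eqxx.
Qed.

(** The value F(b), except that each power b_i^(a_i) is replaced by a falling
    factorial. *)
Definition falling_eval F b : R := \sum_(a <- msupp F) F@_a * (mffact b a)%:R.

(** By induction on m: multiplication by the sum of the variables adds the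
    coefficients at all the b - U_i, and the factors b_i - a_i that come out sum to
    the degree of b minus that of F, which is m + 1. *)
Lemma mcoeff_expsum_mul d m F b : F \is d.-homog -> mdeg b = (m + d)%N ->
  (mfact b)%:R * ((\sum_i 'X_i) ^+ m * F)@_b = m`!%:R * falling_eval F b.
Proof.
move=> hF; elim: m b => [|m IH] b db.
  rewrite expr0 mul1r fact0 mul1r /falling_eval.
  have [bF|bF] := boolP (b \in msupp F); last first.
    rewrite memN_msupp_eq0 // mulr0 big_seq big1 // => a aF.
    rewrite mffact_eq_deg ?mulr0 //; first by rewrite db (dhomogP _ _ _ hF).
    by apply: contraNneq bF => <-.
  rewrite (bigD1_seq b) //= big_seq_cond big1 ?addr0 => [|a /andP[aF ab]].
    by rewrite mffactnn mulrC.
  by rewrite mffact_eq_deg ?mulr0 // db (dhomogP _ _ _ hF).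
rewrite exprS -mulrA mulr_suml raddf_sum /= mulr_sumr.
have step i : (mfact b)%:R * ('X_i * ((\sum_i 'X_i) ^+ m * F))@_b =
    m`!%:R * \sum_(a <- msupp F) F@_a * ((b i)%:R - (a i)%:R) * (mffact b a)%:R.
  have -> : \sum_(a <- msupp F) F@_a * ((b i)%:R - (a i)%:R) * (mffact b a)%:R =
      (b i)%:R * falling_eval F (b - U_(i)).
    rewrite mulr_sumr; apply: eq_bigr => a _.
    rewrite mulrCA -natrM mffact_rec natrM -mulrA; congr (_ * _).
    have [ab|ba] := leqP (a i) (b i); first by rewrite natrB.
    by rewrite (mffact_small ba) !mulr0.
  rewrite mcoeff_mulX; case: ifPn => [bi|]; last first.
    by rewrite -eqn0Ngt => /eqP ->; rewrite mul0r !mulr0.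
  rewrite (mfact_rec bi) natrM -mulrA IH; first by rewrite mulrCA.
  by apply/eqP; rewrite -(eqn_add2r 1) -{1}(mdeg1 i) -mdegD submK ?db ?addn1 //;
    apply/mnm_lepP => j; rewrite mnm1E; case: eqP => [<-|].
rewrite (eq_bigr _ (fun i _ => step i)) -mulr_sumr exchange_big /=.
rewrite factS natrM [_%:R * m`!%:R]mulrC -mulrA; congr (_ * _).
rewrite mulr_sumr big_seq [RHS]big_seq; apply: eq_bigr => a aF.
rewrite -mulr_suml -mulr_sumr sumrB -!natr_sum -!mdegE db.
rewrite (dhomogP _ _ _ hF a aF) natrD addrK.
by rewrite mulrA [_ * F@_a]mulrC.
Qed.

(** Here x is a product of k factors in [0, M] and y is obtained by lowering the
    factors by bounded amounts.  The last inequality bounds x - y by c M^(k-1);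
    multiplying by M avoids the predecessor and makes the constants additive under
    products. *)
Definition falling_close (M : R) (k : nat) (c x y : R) : Prop :=
  [/\ 0 <= y, y <= x, x <= M ^+ k & M * (x - y) <= c * M ^+ k].

Lemma falling_closeM (M : R) k1 k2 c1 c2 x1 x2 y1 y2 : 0 <= M ->
  falling_close M k1 c1 x1 y1 -> falling_close M k2 c2 x2 y2 ->
  falling_close M (k1 + k2) (c1 + c2) (x1 * x2) (y1 * y2).
Proof.
move=> M0 [y10 yx1 xM1 d1] [y20 yx2 xM2 d2].
have x10 := le_trans y10 yx1; have x20 := le_trans y20 yx2.
split; [exact: mulr_ge0|exact: ler_pM|by rewrite exprD; exact: ler_pM|].
have -> : M * (x1 * x2 - y1 * y2) = M * (x1 - y1) * x2 + y1 * (M * (x2 - y2)).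
  by ring.
rewrite mulrDl exprD; apply: lerD.
  rewrite mulrA; apply: ler_pM => //.
  by rewrite mulr_ge0 // subr_ge0.
rewrite [leRHS]mulrCA; apply: ler_pM => //; last exact: (le_trans yx1 xM1).
by rewrite mulr_ge0 // subr_ge0.
Qed.

Lemma falling_close_ffact (M k a : nat) : (k <= M)%N ->
  falling_close M%:R a (\sum_(j < a) j%:R) (k%:R ^+ a) (k ^_ a)%:R.
Proof.
move=> kM; elim: a => [|a IH].
  by rewrite big_ord0 ffactn0 !expr0; split=> //; rewrite subrr mulr0 mul0r.
rewrite big_ord_recr /= exprSr ffactnSr natrM -[a.+1]addn1.
apply: falling_closeM => //; split; rewrite ?ler0n ?expr1 ?ler_nat ?leq_subr //.
rewrite -natrM -natrB ?leq_subr // -natrM ler_nat mulnC leq_mul2r; apply/orP; right.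
by rewrite leq_subLR addnC -leq_subLR.
Qed.

Lemma falling_close_mffact a : exists c : R, forall b,
  falling_close (mdeg b)%:R (mdeg a) c
    (\prod_i (b i)%:R ^+ a i) (mffact b a)%:R.
Proof.
exists (\sum_i \sum_(j < a i) j%:R) => b.
rewrite [mdeg a]mdegE natr_prod.
elim: (index_enum _) => [|i r IH].
  by rewrite !big_nil; split=> //; rewrite subrr mulr0 mul0r.
rewrite !big_cons; apply: falling_closeM => //; apply: falling_close_ffact.
by rewrite mdegE (bigD1 i) //= leq_addr.
Qed.

Lemma falling_eval_close d F : F \is d.-homog -> exists c : R, forall b,
  (mdeg b)%:R * (F.@[fun i => (b i)%:R] - falling_eval F b)
    <= c * (mdeg b)%:R ^+ d.
Proof.
move=> hF.
pose E a b : R := (mdeg b)%:R * (\prod_i (b i)%:R ^+ a i - (mffact b a)%:R).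
suff [c cP] : exists c : R, forall b,
    \sum_(a <- msupp F) `|F@_a| * E a b <= c * (mdeg b)%:R ^+ d.
  exists c => b; apply: le_trans (cP b).
  rewrite mevalE /falling_eval -sumrB mulr_sumr; apply: ler_sum => a _.
  rewrite -mulrBr mulrCA; apply: ler_wpM2r; last exact: ler_norm.
  have [c' /(_ b)[_ yx _ _]] := falling_close_mffact a.
  by rewrite mulr_ge0 // subr_ge0.
have : {in msupp F, forall a, mdeg a = d} by apply: dhomogP.
elim: (msupp F) => [|a s IH] sd.
  by exists 0 => b; rewrite big_nil mul0r.
have [c1 c1P] := IH (fun a' a's => sd a' (@mem_behead _ (a :: s) _ a's)).
have [c2 c2P] := falling_close_mffact a.
exists (`|F@_a| * c2 + c1) => b; rewrite big_cons mulrDl; apply: lerD; last exact: c1P.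
rewrite -mulrA ler_wpM2l ?normr_ge0 //; have [_ _ _] := c2P b.
by rewrite (sd a (mem_head _ _)).
Qed.

(** Up to positive factors the coefficient at b is [falling_eval F b], which
    differs from F(b) >= mu |b|^d by at most c |b|^(d-1), where |b| = m + d is the
    degree of b.  It is nonnegative as soon as |b| >= c / mu. *)
Lemma polya d F (mu : R) : F \is d.-homog -> 0 < mu ->
    (forall u : 'I_n -> R, (forall i, 0 <= u i) -> mu * (\sum_i u i) ^+ d <= F.@[u]) ->
  exists m0, forall m, (m0 <= m)%N ->
    forall b, 0 <= ((\sum_i 'X_i) ^+ m * F)@_b.
Proof.
move=> hF mu0 Fmu; have [c cP] := falling_eval_close hF.
exists (Num.truncn (c / mu)).+1 => m mc b.
have hG : ((\sum_i 'X_i) ^+ m * F) \is (m + d).-homog.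
  apply: dhomogM => //; rewrite -[m in m.-homog]mul1n; apply: dhomogMn.
  by apply: rpred_sum => i _; rewrite dhomogX /= mdeg1.
have [db|nb] := eqVneq (mdeg b) (m + d)%N; last first.
  by rewrite (dhomog_nemf_coeff hG).
have b0 : 0 < (mfact b)%:R :> R by rewrite ltr0n mfact_gt0.
rewrite -(pmulr_rge0 _ b0) (mcoeff_expsum_mul hF db); apply: mulr_ge0 => //.
have M0 : 0 < (mdeg b)%:R :> R.
  by rewrite ltr0n db ltn_addr //; case: (m) mc.
have cM : c <= mu * (mdeg b)%:R.
  rewrite mulrC -ler_pdivrMr // (le_trans (ltW (truncnS_gt _))) //.
  by rewrite ler_nat db (leq_trans mc) ?leq_addr.
rewrite -(pmulr_rge0 _ M0).
have := cP b; rewrite mulrBr lerBlDr -lerBlDl; apply: le_trans.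
rewrite subr_ge0 (le_trans (ler_wpM2r _ cM)) ?exprn_ge0 //.
rewrite [mu * _]mulrC -mulrA; apply: ler_wpM2l => //.
have -> : (mdeg b)%:R = \sum_i (b i)%:R :> R by rewrite mdegE natr_sum.
exact: Fmu.
Qed.

End Polya.

(** * Positive definite forms *)

Lemma dhomog1X (S : nzRingType) k (q : {mpoly S[k]}) d :
  q \is 1.-homog -> q ^+ d \is d.-homog.
Proof. by move=> hq; have := dhomogMn d hq; rewrite mul1n. Qed.

Lemma mpevalM (R : realType) n (p q : {mpoly R[n]}) x :
  mpeval (p * q) x = mpeval p x * mpeval q x.
Proof. exact: mevalM. Qed.

Lemma mpevalX (R : realType) n (p : {mpoly R[n]}) k x :
  mpeval (p ^+ k) x = mpeval p x ^+ k.
Proof. exact: rmorphXn. Qed.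

Lemma mpeval_sqnorm (R : realType) n (x : 'rV[R]_n) :
  mpeval (sqnorm R n) x = \sum_i x 0 i ^+ 2.
Proof.
rewrite /mpeval rmorph_sum /=; apply: eq_bigr => i _.
by rewrite rmorphXn /= mevalXU.
Qed.

Lemma sqnorm_gt0 (R : realType) n (x : 'rV[R]_n) : x != 0 -> 0 < \sum_i x 0 i ^+ 2.
Proof.
move=> x0; rewrite lt0r sumr_ge0 ?andbT => [|i _]; last exact: sqr_ge0.
apply: contraNneq x0 => /eqP; rewrite psumr_eq0 => [/allP h|i _]; last exact: sqr_ge0.
apply/eqP/rowP => i; rewrite mxE; apply/eqP.
by rewrite -(sqrf_eq0 (x 0 i)); apply: h; rewrite mem_index_enum.
Qed.

Section LowerBound.
Variables (R : realType) (n : nat).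
Implicit Types (p : {mpoly R[n.+1]}).

(** A form of odd degree changes sign from x to -x. *)
Lemma posdef_even d p : p \is d.-homog -> posdef p -> ~~ odd d.
Proof.
move=> /dhomog_scaling hp pp.
pose x : 'rV[R]_n.+1 := const_mx 1.
have x0 : x != 0 by apply/negP => /eqP/rowP/(_ 0) /eqP; rewrite !mxE oner_eq0.
apply/negP => od; have := pp (-1 *: x); rewrite scaler_eq0 oppr_eq0.
rewrite oner_eq0 (negbTE x0).
move=> /(_ isT); rewrite hp -signr_odd od expr1 mulN1r oppr_gt0.
by rewrite ltNge ltW // pp.
Qed.

(** The constant mu is the minimum of p on the unit sphere; homogeneity extends
    the bound to all x. *)
Lemma posdef_lower_bound e p : p \is (2 * e).-homog -> posdef p ->
  exists2 mu : R, 0 < mu &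
    forall x : 'rV[R]_n.+1, mu * (\sum_i x 0 i ^+ 2) ^+ e <= mpeval p x.
Proof.
move=> /dhomog_scaling hp pp.
have [z z1 zmin] := polynomial_function_min_sphere (msupp p) (fun m => p@_m)
  (fun m : 'X_{1..n.+1} => (m : 'I_n.+1 -> nat)).
have z0 : z != 0.
  apply/eqP => z0; move/eqP: z1; rewrite z0 big1 => [|i _]; last first.
    by rewrite mxE expr0n.
  by rewrite eq_sym oner_eq0.
exists (mpeval p z) => [|x]; first exact: pp.
(* For x = 0, take r = 0 and any y on the sphere. *)
suff [r [y [y1 ->]]] : exists r (y : 'rV[R]_n.+1), \sum_i y 0 i ^+ 2 = 1 /\ x = r *: y.
  rewrite hp; under eq_bigr do rewrite mxE exprMn.
  rewrite -mulr_sumr y1 mulr1 -exprM mulrC ler_wpM2l //.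
    by rewrite exprM exprn_ge0 // sqr_ge0.
  by have := zmin y y1; rewrite /mpeval !mevalE.
have [->|x0] := eqVneq x 0; first by exists 0, z; rewrite scale0r.
have s0 := sqnorm_gt0 x0.
exists (Num.sqrt (\sum_i x 0 i ^+ 2)), ((Num.sqrt (\sum_i x 0 i ^+ 2))^-1 *: x).
split; last by rewrite scalerA divff ?scale1r // gt_eqF // sqrtr_gt0.
under eq_bigr do rewrite mxE exprMn.
by rewrite -mulr_sumr exprVn sqr_sqrtr ?mulVf ?gt_eqF // ltW.
Qed.

End LowerBound.

(** * Even part of a sum of squares modulo t^2 - c *)

Section EvenPart.
Variable (S : comNzRingType).
Implicit Types (p q : {poly S}) (c a : S).

Lemma even_poly_comp p q : even_poly (p \Po 'X^2 + (q \Po 'X^2) * 'X) = p.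
Proof.
apply/polyP => i; rewrite coef_even_poly coefD coefMX !coef_comp_poly_Xn //.
rewrite dvdn2 odd_double divn2 doubleK; case: i => [|i]; first by rewrite addr0.
by rewrite doubleS /= dvdn2 /= odd_double addr0.
Qed.

(** Writing q = u(t^2) + t v(t^2), the even part of q^2 at t^2 = c is
    u(c)^2 + c v(c)^2, and the even part of a multiple of t^2 - c vanishes there. *)
Lemma sos_mod_polyC c a : sos_mod 0 c ->
  sos_mod ('X^2 - c%:P) a%:P -> sos_mod 0 a.
Proof.
move=> sc [qs [h aE]].
pose E p := (even_poly p).[c].
have Esqr q : E (q ^+ 2) = (even_poly q).[c] ^+ 2 + c * (odd_poly q).[c] ^+ 2.
  rewrite /E -{1}(poly_even_odd q); set u := even_poly q; set v := odd_poly q.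
  have -> : (u \Po 'X^2 + (v \Po 'X^2) * 'X) ^+ 2 =
     ((u * u + v * v * 'X) \Po 'X^2) + ((u * v + u * v) \Po 'X^2) * 'X.
    by rewrite !comp_polyD !comp_polyM comp_polyX; ring.
  by rewrite even_poly_comp hornerD !hornerM hornerX; ring.
have Eh : E (('X^2 - c%:P) * h) = 0.
  rewrite /E -{1}(poly_even_odd h); set u := even_poly h; set v := odd_poly h.
  have -> : ('X^2 - c%:P) * (u \Po 'X^2 + (v \Po 'X^2) * 'X) =
     ((('X - c%:P) * u) \Po 'X^2) + ((('X - c%:P) * v) \Po 'X^2) * 'X.
    by rewrite !comp_polyM comp_polyB comp_polyX comp_polyC; ring.
  by rewrite even_poly_comp !hornerE subrr mul0r.
have -> : a = E a%:P by rewrite /E even_polyC hornerC.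
rewrite aE /E linearD hornerD -!/(E _) Eh addr0 /E linear_sum horner_sum.
apply: sos_mod_sum => q _; rewrite -/(E _) Esqr.
by apply: sos_modD; [|apply: sos_modM => //]; exact: sos_mod_sqr.
Qed.

Lemma sos_mod_congr (d g1 g2 h : S) : g1 = g2 + d * h -> sos_mod d g1 -> sos_mod d g2.
Proof.
move=> gE [qs [k g1E]]; exists qs, (k - h).
have -> : g2 = g1 - d * h by rewrite gE addrK.
by rewrite g1E; ring.
Qed.

End EvenPart.

(** * The theorem of Reznick *)

Section Reznick.
Variables (R : realType) (n' : nat).
Let n := n'.+1.
Let A := {mpoly R[n]}.
Let B := {poly A}.
Let kappa : R := (n.*2%:R)^-1.

Let sphere : B := 'X^2 - (sqnorm R n)%:P.

Let scal (c : R) : B := c%:MP%:P.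

(** Linear forms in x and t = 'X, normalized so that their sum is t.  They are
    nonnegative for t >= |x|, and their number n + 1 makes them coordinates on the
    space of (x, t). *)
Definition cone_form (i : 'I_n.+1) : B :=
  scal kappa * (if unlift ord0 i is Some j then 'X + ('X_j)%:P
                else \sum_j ('X - ('X_j)%:P)).

Lemma scalM (c1 c2 : R) : scal (c1 * c2) = scal c1 * scal c2.
Proof. by rewrite /scal mpolyCM polyCM. Qed.

Lemma scalMn k : scal k%:R = k%:R.
Proof. by rewrite /scal !rmorph_nat. Qed.

Lemma scal_kappaK : scal kappa * n.*2%:R = 1.
Proof.
by rewrite -scalMn -scalM /kappa mulVf ?scalMn // pnatr_eq0.
Qed.

Lemma cone_form0 : cone_form ord0 = scal kappa * \sum_j ('X - ('X_j)%:P).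
Proof. by rewrite /cone_form unlift_none. Qed.

Lemma cone_form_lift j : cone_form (lift ord0 j) = scal kappa * ('X + ('X_j)%:P).
Proof. by rewrite /cone_form liftK. Qed.

Lemma sum_cone_form : \sum_i cone_form i = 'X.
Proof.
rewrite big_ord_recl cone_form0; under [X in _ + X]eq_bigr do rewrite cone_form_lift.
rewrite -mulr_sumr -mulrDr -big_split /=.
under eq_bigr do rewrite addrACA addNr addr0.
rewrite sumr_const card_ord -mulr2n -mulrnA mul2n -mulr_natr.
by rewrite mulrCA scal_kappaK mulr1.
Qed.

(** From 2 t (t + y) = (t + y)^2 + (|x|^2 - y^2) + (t^2 - |x|^2). *)
Lemma sos_mod_X_add (y : A) : sos (sqnorm R n - y ^+ 2) ->
  sos_mod sphere ('X * (scal kappa * ('X + y%:P))).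
Proof.
move=> /sosE [qs [h0]]; rewrite mul0r addr0 => qsE.
have -> : 'X * (scal kappa * ('X + y%:P)) =
    scal (kappa / 2) * (('X + y%:P) ^+ 2 + (\sum_(q <- qs) q%:P ^+ 2) + sphere).
  have -> : \sum_(q <- qs) q%:P ^+ 2 = (sqnorm R n)%:P - y%:P ^+ 2.
    rewrite -!rmorphXn -rmorphB qsE rmorph_sum /=.
    by apply: eq_bigr => q _; rewrite rmorphXn.
  have {1}-> : kappa = kappa / 2 * 2 by rewrite mulfVK ?pnatr_eq0.
  by rewrite scalM scalMn /sphere; ring.
apply: sos_modM.
  rewrite /scal mpolyC_sqr; last by rewrite mulr_ge0 ?invr_ge0 ?ler0n.
  by rewrite rmorphXn; exact: sos_mod_sqr.
apply: sos_modD; last by exists [::], 1; rewrite big_nil add0r mulr1.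
apply: sos_modD; first exact: sos_mod_sqr.
by apply: sos_mod_sum => q _; exact: sos_mod_sqr.
Qed.

Lemma sos_mod_cone_form i : sos_mod sphere ('X * cone_form i).
Proof.
case: (unliftP ord0 i) => [j ->|->]; rewrite ?cone_form0 ?cone_form_lift.
  exact/sos_mod_X_add/sos_sqnormB.
rewrite !mulr_sumr; apply: sos_mod_sum => j _.
by rewrite -polyCN; apply: sos_mod_X_add; rewrite sqrrN; exact: sos_sqnormB.
Qed.

Definition cone_eval : {mpoly R[n.+1]} -> B :=
  mmap (@polyC A \o @mpolyC n R) cone_form.
HB.instance Definition _ := GRing.RMorphism.on cone_eval.

Lemma cone_evalX i : cone_eval 'X_i = cone_form i.
Proof. by rewrite /cone_eval mmapX mmap1U. Qed.

Lemma cone_evalZ c q : cone_eval (c *: q) = scal c * cone_eval q.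
Proof. exact: mmapZ. Qed.

(** The coordinates x_j written in terms of the linear forms [cone_form i]. *)
Definition cone_coord : n.-tuple {mpoly R[n.+1]} :=
  [tuple n.*2%:R *: 'X_(lift ord0 j) - \sum_i 'X_i | j < n].

Lemma cone_eval_coord j : cone_eval (tnth cone_coord j) = ('X_j)%:P.
Proof.
rewrite tnth_mktuple rmorphB /= cone_evalZ rmorph_sum /= cone_evalX.
under eq_bigr do rewrite cone_evalX.
rewrite sum_cone_form cone_form_lift mulrA scalMn [_%:R * _]mulrC scal_kappaK.
by rewrite mul1r addrC addKr.
Qed.

Lemma cone_eval_comp p : cone_eval (p \mPo cone_coord) = p%:P.
Proof.
rewrite comp_mpolyEX rmorph_sum /= [p in RHS]mpolyE rmorph_sum /=.
apply: eq_bigr => m _; rewrite cone_evalZ comp_mpolyX rmorph_prod /=.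
rewrite -mul_mpolyC polyCM; congr (_ * _).
rewrite mpolyXE_id rmorph_prod /=; apply: eq_bigr => j _.
by rewrite !rmorphXn /= cone_eval_coord.
Qed.

Lemma cone_coord_homog j : tnth cone_coord j \is 1.-homog.
Proof.
have hX i : 'X_i \is [in R[n.+1], 1.-homog] by rewrite dhomogX /= mdeg1.
rewrite tnth_mktuple rpredB //; first by rewrite rpredZ.
by apply: rpred_sum => i _.
Qed.

Lemma comp_homog d p : p \is d.-homog -> (p \mPo cone_coord) \is d.-homog.
Proof.
move=> hp; rewrite comp_mpolyEX big_seq; apply: rpred_sum => m mp.
have dE : mdeg m = d := dhomogP _ _ _ hp m mp.
rewrite rpredZ // comp_mpolyX -dE mdegE.
elim: (index_enum _) => [|j r IH]; first by rewrite !big_nil dhomog1.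
rewrite !big_cons; apply: dhomogM => //.
exact/dhomog1X/cone_coord_homog.
Qed.

Lemma sqnorm_homog : sqnorm R n \is 2.-homog.
Proof.
apply: rpred_sum => i _; apply: dhomog1X.
by rewrite dhomogX /= mdeg1.
Qed.

Lemma sum_cone_evalX : cone_eval (\sum_i 'X_i) = 'X.
Proof.
rewrite rmorph_sum -[RHS]sum_cone_form; apply: eq_bigr => i _.
exact: cone_evalX.
Qed.

(** A monomial of degree d in the [cone_form i] absorbs t^d, one factor t for
    each linear form. *)
Lemma sos_mod_cone_eval d G : G \is d.-homog -> (forall b, 0 <= G@_b) ->
  sos_mod sphere ('X ^+ d * cone_eval G).
Proof.
move=> hG G0; rewrite [G in cone_eval G]mpolyE rmorph_sum /= mulr_sumr.
rewrite big_seq; apply: sos_mod_sum => b bG.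
rewrite cone_evalZ mulrCA; apply: sos_modM.
  by rewrite /scal mpolyC_sqr // rmorphXn; exact: sos_mod_sqr.
have dE : mdeg b = d := dhomogP _ _ _ hG b bG.
rewrite -dE mdegE mpolyXE_id rmorph_prod /=.
rewrite -prodrXr -big_split /=; apply: sos_mod_prod => i _.
rewrite rmorphXn /= cone_evalX -exprMn; apply: sos_modX.
exact: sos_mod_cone_form.
Qed.

(** The form F below is p - mu |x|^(2e) + mu t^(2e), written in the coordinates
    given by the [cone_form i]. *)
Theorem reznick e p : p \is (2 * e).-homog -> posdef p ->
  exists m0, forall m, (m0 <= m)%N -> sos (sqnorm R n ^+ m * p).
Proof.
move=> hp pp; have [mu mu0 p_ge] := posdef_lower_bound hp pp.
pose T : {mpoly R[n.+1]} := \sum_i 'X_i.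
pose F := (p - mu *: sqnorm R n ^+ e) \mPo cone_coord + mu *: T ^+ (2 * e).
have hT : T \is 1.-homog by apply: rpred_sum => i _; rewrite dhomogX /= mdeg1.
have hF : F \is (2 * e).-homog.
  apply: rpredD; last first.
    by rewrite rpredZ //; exact: dhomog1X.
  by apply: comp_homog; rewrite rpredB // rpredZ //; exact/dhomogMn/sqnorm_homog.
(* The sum of the u_i is the value of t, and p - mu |x|^(2e) is nonnegative
   everywhere. *)
have F_ge (u : 'I_n.+1 -> R) : (forall i, 0 <= u i) ->
    mu * (\sum_i u i) ^+ (2 * e) <= F.@[u].
  move=> _; have TE : T.@[u] = \sum_i u i.
    by rewrite rmorph_sum /=; apply: eq_bigr => i _; rewrite mevalXU.
  rewrite /F mevalD mevalZ rmorphXn /= TE lerDr comp_mpoly_meval.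
  rewrite mevalB mevalZ rmorphXn subr_ge0 /=.
  have := p_ge (\row_j (tnth cone_coord j).@[u]); rewrite /mpeval.
  rewrite (@meval_eq _ _ _ (fun j => (tnth cone_coord j).@[u])) => [|j];
    last by rewrite mxE.
  apply: le_trans; rewrite /sqnorm rmorph_sum ler_wpM2l ?(ltW mu0) //=.
  under eq_bigr do rewrite rmorphXn /= mevalXU.
  by under [in leRHS]eq_bigr do rewrite mxE.
have [m0 m0P] := polya hF mu0 F_ge.
exists (m0 + e)%N => k /subnK <-; rewrite addnA.
move: (_ + m0)%N (leq_addl (k - (m0 + e)) m0) => {k} m m0m.
have hG : T ^+ m * F \is (m + 2 * e).-homog.
  by apply: dhomogM => //; exact: dhomog1X.
have := sos_mod_cone_eval hG (m0P m m0m).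
set s := sqnorm R n; set P : B := p%:P.
have -> : cone_eval (T ^+ m * F) =
    'X ^+ m * (P + scal mu * (('X ^+ 2) ^+ e - s%:P ^+ e)).
  rewrite rmorphM rmorphD /= rmorphXn /= sum_cone_evalX; congr (_ * _).
  rewrite cone_eval_comp cone_evalZ rmorphXn /= sum_cone_evalX -exprM.
  rewrite rmorphB /= -mul_mpolyC rmorphM /= rmorphXn /= -/(scal mu) -/P; ring.
(* Powers of t^2 and of |x|^2 agree modulo t^2 - |x|^2. *)
have geom k : exists S, ('X ^+ 2) ^+ k = s%:P ^+ k + sphere * S.
  exists (\sum_(i < k) ('X ^+ 2) ^+ (k.-1 - i) * s%:P ^+ i).
  by rewrite /sphere -subrXX addrC subrK.
have [S1 S1E] := geom e; have [S2 S2E] := geom (m + e)%N.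
rewrite mulrA -exprD (_ : m + 2 * e + m = 2 * (m + e))%N;
  last by rewrite addnAC addnn -mul2n -mulnDr.
rewrite exprM S1E S2E => H; apply/sosE.
have s_sos : sos_mod 0 s by apply/sosE/sos_sqnorm.
apply: (sos_mod_polyC s_sos); apply: (sos_mod_congr
  (h := s%:P ^+ (m + e) * scal mu * S1 + S2 * (P + scal mu * (sphere * S1))) _ H).
rewrite rmorphM /= rmorphXn /= -/P; ring.
Qed.

End Reznick.

(** * Multiplication by powers of a fixed sum of squares *)

Lemma bernoulli (R : realType) (c : R) N : 0 <= c <= 1 -> (1 + N%:R * c) * (1 - c) ^+ N <= 1.
Proof.
move=> /andP[c0 c1]; elim: N => [|N IH]; first by rewrite mul0r addr0 expr0 mulr1.
apply: le_trans IH; rewrite exprS mulrA ler_wpM2r ?exprn_ge0 ?subr_ge0 //.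
rewrite -natr1 -subr_ge0.
have -> : 1 + N%:R * c - (1 + (N%:R + 1) * c) * (1 - c) = (N%:R + 1) * c ^+ 2 by ring.
by rewrite mulr_ge0 ?addr_ge0 ?sqr_ge0.
Qed.

(** The inequality (1 + N c) (1 - c)^N <= 1 bounds the power by 1 / (N c). *)
Lemma small_power (R : realType) (c L delta : R) : 0 < c -> c <= 1 -> 0 < L -> 0 < delta ->
  exists N, L * (1 - c) ^+ N <= delta.
Proof.
move=> c0 c1 L0 d0; exists (Num.truncn (L / (delta * c))).+1.
set N := _.+1.
have N_gt : L <= N%:R * (delta * c).
  by rewrite -ler_pdivrMr ?mulr_gt0 // ltW // truncnS_gt.
have t0 : 0 <= (1 - c) ^+ N by rewrite exprn_ge0 ?subr_ge0.
apply: (@le_trans _ _ (N%:R * (delta * c) * (1 - c) ^+ N)); first exact: ler_wpM2r.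
have := @bernoulli R c N; rewrite (ltW c0) c1 => /(_ isT) b1.
rewrite mulrCA -!mulrA -[leRHS]mulr1 ler_wpM2l ?(ltW d0) // mulrA.
by apply: le_trans b1; rewrite ler_wpM2r // lerDr.
Qed.

Section Saturation.
Variables (R : realType) (n : nat) (U : {mpoly R[n]}).
Hypothesis sosU : sos U.
Implicit Types (g h s sigma : {mpoly R[n]}).

Definition saturated g : Prop := exists k, sos (U ^+ k * g).

Lemma sos_saturated g : sos g -> saturated g.
Proof. by exists 0; rewrite expr0 mul1r. Qed.

Lemma saturatedM g h : saturated g -> saturated h -> saturated (g * h).
Proof.
move=> [k sg] [l sh]; exists (k + l)%N.
by rewrite exprD mulrACA; exact: sosM.
Qed.

Lemma saturatedD g h : saturated g -> saturated h -> saturated (g + h).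
Proof.
move=> [k sg] [l sh]; exists (k + l)%N; rewrite mulrDr exprD -mulrA mulrCA.
by apply: sosD; [|rewrite -mulrA]; apply: sosM => //; exact: sosX.
Qed.

Lemma saturatedX g k : saturated g -> saturated (g ^+ k).
Proof.
move=> sg; elim: k => [|k IH]; first exact/sos_saturated/sos1.
by rewrite exprS; exact: saturatedM.
Qed.

Lemma saturated_sum m (F : 'I_m -> {mpoly R[n]}) :
  (forall i, saturated (F i)) -> saturated (\sum_i F i).
Proof.
by move=> sF; apply: big_ind => //; [exact/sos_saturated/sos0|exact: saturatedD].
Qed.

Lemma saturatedK j g : saturated (U ^+ j * g) -> saturated g.
Proof. by move=> [k]; rewrite mulrA -exprD; exists (k + j)%N. Qed.

Lemma saturated_base : saturated U.
Proof. exact: sos_saturated. Qed.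

Lemma saturated_geometric x y k : saturated x -> saturated y ->
  saturated (\sum_(i < k) x ^+ (k.-1 - i) * y ^+ i).
Proof.
by move=> sx sy; apply: saturated_sum => i; apply: saturatedM; exact: saturatedX.
Qed.

(** Write a = s^m and b = U^m.  From b (b - a) = (b - a)^2 + a (b - a) and
    cancellation of b, the polynomial b - a is saturated, so that a <= b for the
    order given by saturated polynomials; on the other side a >= c b with
    c = K^(-m).  Now b^N h is the sum of a h Q and (b - a)^N h, where
    Q is the sum of the b^(N-1-i) (b - a)^i.  The first term is saturated, and the
    second is at least - L (b - a)^N sigma >= - L (1 - c)^N b^N sigma, which a
    large N makes small compared with delta b^N sigma. *)
Lemma saturated_perturb s sigma h m (K L delta : R) :
    sos s -> sos sigma -> 1 <= K -> 0 < L -> 0 < delta ->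
    saturated (s ^+ m * (U - s)) -> sos (K *: s - U) ->
    saturated (s ^+ m * h) -> sos (L *: sigma + h) ->
  saturated (h + delta *: sigma).
Proof.
move=> ss ssig K1 L0 d0 sUs sKs sh sL.
have K0 : 0 < K by apply: lt_le_trans K1.
pose a := s ^+ m; pose b := U ^+ m; pose c := (K ^+ m)^-1.
have c0 : 0 < c by rewrite invr_gt0 exprn_gt0.
have c1 : c <= 1 by rewrite invf_le1 ?exprn_gt0 // exprn_ege1.
have sa : saturated a by apply/sos_saturated/sosX.
have sb : saturated b by apply/saturatedX/saturated_base.
have sba : saturated (b - a).
  apply: (@saturatedK m); rewrite -/b.
  have -> : b * (b - a) = (b - a) ^+ 2 + a * (b - a) by ring.
  apply: saturatedD; first exact/sos_saturated/sos_sqr.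
  rewrite /a /b subrXX mulrA; apply: saturatedM => //.
  by apply: saturated_geometric; [exact: saturated_base|exact: sos_saturated].
(* Multiplying a - c b by K^m gives (K s)^m - U^m, a multiple of K s - U. *)
have sac : saturated ((1 - c) *: b - (b - a)).
  have -> : (1 - c) *: b - (b - a) = c%:MP * ((K *: s) ^+ m - U ^+ m).
    rewrite mul_mpolyC exprZn scalerBr scalerA mulVf ?gt_eqF ?exprn_gt0 //.
    by rewrite scale1r scalerBl scale1r -/a -/b; ring.
  apply: saturatedM; first exact/sos_saturated/sosC/ltW.
  rewrite subrXX; apply: saturatedM; first exact: sos_saturated.
  apply: saturated_geometric; last exact: saturated_base.
  by apply/sos_saturated/sosZ => //; exact: ltW.
have [N NP] := small_power c0 c1 L0 d0.
have -> : h + delta *: sigma =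
    (h + (L * (1 - c) ^+ N) *: sigma) + (delta - L * (1 - c) ^+ N) *: sigma.
  by rewrite scalerBl; ring.
apply: saturatedD; last by apply/sos_saturated/sosZ; rewrite ?subr_ge0.
apply: (@saturatedK (m * N)); rewrite exprM -/b.
have -> : b ^+ N * (h + (L * (1 - c) ^+ N) *: sigma) =
    (a * h) * (\sum_(i < N) b ^+ (N.-1 - i) * (b - a) ^+ i)
    + (b - a) ^+ N * (L *: sigma + h)
    + (L *: sigma) * (((1 - c) *: b) ^+ N - (b - a) ^+ N).
  have aq : a * (\sum_(i < N) b ^+ (N.-1 - i) * (b - a) ^+ i) = b ^+ N - (b - a) ^+ N.
    by rewrite (subrXX b); congr (_ * _); ring.
  by rewrite mulrAC aq exprZn -!mul_mpolyC !rmorphM /=; ring.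
have sLsig : sos (L *: sigma) by apply: sosZ => //; exact: ltW.
apply: saturatedD; first apply: saturatedD.
- by apply: saturatedM => //; exact: saturated_geometric.
- by apply: saturatedM; [exact: saturatedX|exact: sos_saturated].
apply: saturatedM; first exact: sos_saturated.
rewrite (subrXX ((1 - c) *: b)); apply: saturatedM => //.
apply: saturated_geometric => //.
rewrite -mul_mpolyC; apply: saturatedM => //.
by apply/sos_saturated/sosC; rewrite subr_ge0.
Qed.

End Saturation.

(** * Multiplication of a positive definite form by powers of another one *)

Lemma posdef_subr_sqnorm (R : realType) n e (p : {mpoly R[n.+1]}) :
    p \is (2 * e).-homog -> posdef p ->
  exists2 eps : R, 0 < eps & posdef (p - eps *: sqnorm R n.+1 ^+ e).
Proof.
move=> hp pp; have [mu mu0 p_ge] := posdef_lower_bound hp pp.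
exists (mu / 2) => [|x x0]; first by rewrite divr_gt0.
rewrite /mpeval mevalB mevalZ -!/(mpeval _ x) subr_gt0.
rewrite mpevalX mpeval_sqnorm; apply: lt_le_trans (p_ge x).
rewrite ltr_pM2r ?exprn_gt0 ?sqnorm_gt0 //.
by rewrite ltr_pdivrMr // ltr_pMr // ltr1n.
Qed.

Lemma sqnormX_homog (R : realType) n e : sqnorm R n.+1 ^+ e \is (2 * e).-homog.
Proof. exact/dhomogMn/sqnorm_homog. Qed.

(** Scheiderer's theorem.  The condition on d excludes a constant V, for which the
    conclusion would say that every positive definite form is a sum of squares. *)
Theorem sos_posdef_mul_powers (R : realType) n d e (V g : {mpoly R[n.+1]}) :
    (0 < d)%N -> V \is d.-homog -> posdef V -> g \is (2 * e).-homog -> posdef g ->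
  exists k, sos ((V ^+ 2) ^+ k * g).
Proof.
move=> d0 hV pV hg pg; set U := V ^+ 2; pose r2 := sqnorm R n.+1.
have hU : U \is (2 * d).-homog by rewrite mulnC; exact: dhomogMn.
have pU : posdef U by move=> x /pV Vx; rewrite mpevalX exprn_gt0.
have [mu mu0 pUs] := posdef_subr_sqnorm hU pU.
have [eps eps0 ph] := posdef_subr_sqnorm hg pg.
pose s := mu *: r2 ^+ d; pose h := g - eps *: r2 ^+ e.
have hs : s \is (2 * d).-homog by rewrite rpredZ // sqnormX_homog.
have hh : h \is (2 * e).-homog by rewrite rpredB // rpredZ // sqnormX_homog.
have [m1 m1P] : exists m0, forall m, (m0 <= m)%N -> sos (r2 ^+ m * (U - s)).
  by apply: (@reznick _ _ d) => //; rewrite rpredB.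
have [m2 m2P] := reznick hh ph.
have [K K0 [_ sK]] := homog_dominates hU.
have [L L0 [sL _]] := homog_dominates hh.
have sr2 : sos r2 by exact: sos_sqnorm.
have ss : sos s by apply: sosZ (ltW mu0) (sosX _ sr2).
pose m := (m1 + m2)%N.
have smE q : s ^+ m * q = mu ^+ m *: (r2 ^+ (d * m) * q).
  by rewrite /s exprZn -exprM -scalerAl.
have dm : (m <= d * m)%N by rewrite leq_pmull.
have [k sk] : saturated U (h + eps *: r2 ^+ e).
  (* The summand 1 in K ensures 1 <= K; it adds s, a sum of squares, to K s - U. *)
  apply: (@saturated_perturb _ _ U (sos_sqr V) s (r2 ^+ e) h m (K / mu + 1) L) => //.
  - exact: sosX.
  - by rewrite lerDr divr_ge0 ?ltW.
  - apply: sos_saturated; rewrite smE; apply: sosZ; first by rewrite exprn_ge0 ?ltW.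
    by apply: m1P; apply: leq_trans dm; rewrite leq_addr.
  - rewrite scalerDl scale1r /s scalerA divfK ?gt_eqF // addrAC.
    exact: sosD.
  - apply: sos_saturated; rewrite smE; apply: sosZ; first by rewrite exprn_ge0 ?ltW.
    by apply: m2P; apply: leq_trans dm; rewrite leq_addl.
by exists k; move: sk; rewrite /h subrK.
Qed.

(** * Derivative along trajectories *)

Section LieDerivative.
Variables (R : realType) (n : nat) (f : 'I_n -> {mpoly R[n]}).

Lemma VdotM p q : Vdot f (p * q) = Vdot f p * q + p * Vdot f q.
Proof.
rewrite /Vdot mulr_suml mulr_sumr -big_split /=; apply: eq_bigr => i _.
by rewrite mderivM; ring.
Qed.

Lemma VdotX p k : Vdot f (p ^+ k.+1) = k.+1%:R * p ^+ k * Vdot f p.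
Proof.
elim: k => [|k IH]; first by rewrite expr1 expr0 !mul1r.
by rewrite exprS VdotM IH -[in RHS]natr1 exprS; ring.
Qed.

Lemma mderiv_homog d (p : {mpoly R[n]}) i : p \is d.-homog -> p^`M(i) \is d.-1.-homog.
Proof.
move=> hp; apply/dhomogP => m; rewrite mcoeff_msupp mcoeff_mderiv => pm.
have /(dhomogP _ _ _ hp) /= : (m + U_(i))%MM \in msupp p.
  by rewrite mcoeff_msupp; apply: contraNneq pm => ->; rewrite mul0rn.
by rewrite mdegD mdeg1 addn1 => <-.
Qed.

Lemma Vdot_homog d e p : p \is d.-homog -> (forall i, f i \is e.-homog) ->
  Vdot f p \is (d.-1 + e).-homog.
Proof.
by move=> hp hf; apply: rpred_sum => i _; apply: dhomogM => //; exact: mderiv_homog.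
Qed.

Lemma Vdot_const p : p \is 0.-homog -> Vdot f p = 0.
Proof.
move=> hp; rewrite /Vdot big1 // => i _.
suff -> : p^`M(i) = 0 by rewrite mul0r.
apply/mpolyP => m; rewrite mcoeff0 mcoeff_mderiv (dhomog_nemf_coeff hp) ?mul0rn //=.
by rewrite mdegD mdeg1 addn1.
Qed.

End LieDerivative.

(** * Existence of a sum of squares Lyapunov function *)

Theorem theorem3p3 (R : realType) (n : nat) (f : 'I_n -> {mpoly R[n]})
    (hf0 : forall i, mpeval (f i) 0 = 0)
    (hf : homogeneous_vf f)
    (hV : exists V : {mpoly R[n]},
        [/\ V \is homog mdeg, posdef V & posdef (- Vdot f V)]) :
  exists W : {mpoly R[n]},
    [/\ W \is homog mdeg,
        sos W /\ posdef W
      & sos (- Vdot f W) /\ posdef (- Vdot f W)].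
Proof.
case: n f hf0 hf hV => [|n] f _ [e fe] [V [/homogP[d hV] pV pVd]].
  have all0 (p : {mpoly R[0]}) : posdef p by move=> x; rewrite thinmx0 eqxx.
  exists 0; split; first by apply/homogP; exists 0; exact: dhomog0.
    by split=> //; exact: sos0.
  by split=> //; rewrite /Vdot big_ord0 oppr0; exact: sos0.
have one0 : const_mx 1 != 0 :> 'rV[R]_n.+1.
  by apply/negP => /eqP/rowP/(_ 0) /eqP; rewrite !mxE oner_eq0.
(* A constant V would have zero derivative along trajectories. *)
have d0 : (0 < d)%N.
  rewrite lt0n; apply: contraTneq (pVd _ one0) => dE.
  by rewrite dE in hV; rewrite Vdot_const // oppr0 /mpeval meval0 ltxx.
pose g := V * (- Vdot f V).
have pg : posdef g by move=> x x0; rewrite mpevalM mulr_gt0 ?pV ?pVd.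
have hg : g \is (d + (d.-1 + e)).-homog.
  by apply: dhomogM => //; rewrite rpredN; exact: Vdot_homog.
have := posdef_even hg pg; rewrite -dvdn2 => /dvdnP[e' e'E].
rewrite e'E mulnC in hg.
have [k sk] := sos_posdef_mul_powers d0 hV pV hg pg.
have VW : - Vdot f (V ^+ (2 * k.+1)) = (2 * k.+1)%:R *: ((V ^+ 2) ^+ k * g).
  rewrite mulnS add2n VdotX -exprM /g -mulNr; set N := (2 * k)%N.
  by rewrite scaler_nat -mulr_natl exprS; ring.
exists (V ^+ (2 * k.+1)); split.
- by apply/homogP; exists (d * (2 * k.+1))%N; exact: dhomogMn.
- split; first by rewrite exprM; exact/sosX/sos_sqr.
  by move=> x x0; rewrite mpevalX exprn_gt0 // pV.
rewrite VW; split; first exact: sosZ.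
move=> x x0; rewrite /mpeval mevalZ -/(mpeval _ x) mulr_gt0 ?ltr0n //.
by rewrite mpevalM mulr_gt0 ?pg // -exprM mpevalX exprn_gt0 ?pV.
Qed.
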